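(* Let $\mathcal V$ be a congruence modular variety, $\mathbb A\in\mathcal V$, $n\ge 2$ and $\theta_0,\dots,\theta_{n-1}\in\mathrm{Con}(\mathbb A)$. Then $$[\theta_0,\dots,\theta_{n-1}]_{TC}=[\theta_0,\dots,\theta_{n-1}]_{H}.$$
   Context: Cube notation. Each $n\in\mathbb N$ is identified with $\{0,\dots,n-1\}$ and $2=\{0,1\}$. For a finite $S\subseteq\mathbb N$, $2^S$ is the set of functions $S\to 2$; $\mathbf 0,\mathbf 1\in 2^S$ are the constant functions. For a set $A$, an element $\gamma=(\gamma_f)_{f\in 2^S}\in A^{2^S}$ is an $(S)$-cube (an $(n)$-cube if $S=n$). For $i\in S$, $j\in 2$, the face $\mathrm{face}_i^j(\gamma)\in A^{2^{S\setminus\{i\}}}$ is $g\mapsto \gamma_{g\cup\{(i,j)\}}$. For $i\in S$ and $\zeta,\eta\in A^{2^{S\setminus\{i\}}}$, $\mathrm{glue}_{\{i\}}(\zeta,\eta)$ is the unique $\gamma$ with $\mathrm{face}_i^0(\gamma)=\zeta$, $\mathrm{face}_i^1(\gamma)=\eta$. For $R\subseteq A^{2^S}$, $\mathrm{face}_i(R)=\{(\mathrm{face}_i^0(\gamma),\mathrm{face}_i^1(\gamma)):\gamma\in R\}$. Further $\mathrm{refl}_i^j(\gamma)=\mathrm{glue}_{\{i\}}(\mathrm{face}_i^j\gamma,\mathrm{face}_i^j\gamma)$ and $\mathrm{sym}_i(\gamma)=\mathrm{glue}_{\{i\}}(\mathrm{face}_i^1\gamma,\mathrm{face}_i^0\gamma)$.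 For $x,y\in A$, $i\in S$, $\mathrm{cube}_i(x,y)\in A^{2^S}$ takes value $x$ at all $f$ with $f(i)=0$ and $y$ at all $f$ with $f(i)=1$. Lines. For $\gamma\in A^{2^S}$, $i\in S$, $f\in 2^{S\setminus\{i\}}$, the $(i)$-cross-section line of $\gamma$ at $f$ is the pair $(\gamma_{f\cup\{(i,0)\}},\gamma_{f\cup\{(i,1)\}})$; for $f=\mathbf 1$ it is the $(i)$-pivot line, and for $f\neq\mathbf 1$ it is an $(i)$-supporting line. For a congruence $\delta$, a $\delta$-pair is a pair in $\delta$. Higher dimensional relations. Let $\mathbb A$ be an algebra and $|S|=n\ge1$. A subuniverse $R$ of $\mathbb A^{2^S}$ is an $(n)$-dimensional tolerance of $\mathbb A$ if $\mathrm{refl}_i^j(\gamma),\mathrm{sym}_i(\gamma)\in R$ for all $\gamma\in R$, $i\in S$, $j\in 2$; it is an $(n)$-dimensional congruence if moreover $\mathrm{face}_i(R)$ is transitive for every $i\in S$. Centrality. For $\delta\in\mathrm{Con}(\mathbb A)$ and $i\in S$, $R\subseteq A^{2^S}$ has $(\delta,i)$-centrality if for every $\gamma\in R$ all of whose $(i)$-supporting lines are $\delta$-pairs, the $(i)$-pivot line of $\gamma$ is a $\delta$-pair; $R$ has $\delta$-centrality if it has $(\delta,i)$-centrality for all $i\in S$. Commutators. For $\theta_k\in\mathrm{Con}(\mathbb A)$ ($k\in S$), $M(\{\theta_k\}_{k\in S})$ is the subuniverse of $\mathbb A^{2^S}$ generated by all $\mathrm{cube}_k(x,y)$ with $k\in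 S$, $(x,y)\in\theta_k$, and $\Delta(\{\theta_k\}_{k\in S})$ is the smallest $(|S|)$-dimensional congruence of $\mathbb A$ containing $M(\{\theta_k\}_{k\in S})$; for $S=n$ write $M(\theta_0,\dots,\theta_{n-1})$, $\Delta(\theta_0,\dots,\theta_{n-1})$. For $n\ge2$, the term condition commutator $[\theta_0,\dots,\theta_{n-1}]_{TC}$ is the least $\delta\in\mathrm{Con}(\mathbb A)$ such that $M(\theta_0,\dots,\theta_{n-1})$ has $\delta$-centrality, and the hypercommutator $[\theta_0,\dots,\theta_{n-1}]_{H}$ is the least $\delta\in\mathrm{Con}(\mathbb A)$ such that $\Delta(\theta_0,\dots,\theta_{n-1})$ has $\delta$-centrality. *)

(* Defs.v *)
From mathcomp Require Import all_boot.
Set Implicit Arguments. Unset Strict Implicit. Unset Printing Implicit Defensive.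

Record signature := Signature { fsym : Type; arity : fsym -> nat }.

Record algebra (sg : signature) := Algebra {
  carrier :> Type;
  op : forall f : fsym sg, ('I_(arity f) -> carrier) -> carrier }.

Arguments op {sg} a f _.

Inductive term (sg : signature) : Type :=
| tvar : nat -> term sg
| tapp : forall f : fsym sg, ('I_(arity f) -> term sg) -> term sg.

Fixpoint eval (sg : signature) (B : algebra sg) (v : nat -> B) (t : term sg) : B :=
  match t with
  | tvar x => v x
  | tapp f ts => op B f (fun j => eval v (ts j))
  end.

Definition models (sg : signature) (Eqs : term sg -> term sg -> Prop) (B : algebra sg) :=
  forall s t, Eqs s t -> forall v : nat -> B, eval v s = eval v t.

Definition is_congruence (sg : signature) (B : algebra sg) (th : B -> B -> Prop) :=
  [/\ (forall x, th x x), (forall x y, th x y -> th y x),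
      (forall x y z, th x y -> th y z -> th x z) &
      (forall f (a b : 'I_(arity f) -> B), (forall j, th (a j) (b j)) ->
          th (op B f a) (op B f b))].

Definition rel_sub (T : Type) (r s : T -> T -> Prop) := forall x y, r x y -> s x y.
Definition rel_eq (T : Type) (r s : T -> T -> Prop) := forall x y, r x y <-> s x y.

Definition con_meet (T : Type) (a b : T -> T -> Prop) : T -> T -> Prop :=
  fun x y => a x y /\ b x y.

Definition con_join (sg : signature) (B : algebra sg) (a b : B -> B -> Prop) : B -> B -> Prop :=
  fun x y => forall th, is_congruence th -> rel_sub a th -> rel_sub b th -> th x y.

Definition con_modular (sg : signature) (B : algebra sg) :=
  forall a b c : B -> B -> Prop,
    is_congruence a -> is_congruence b -> is_congruence c -> rel_sub a c ->
    rel_eq (@con_join _ B a (con_meet b c)) (con_meet (@con_join _ B a b) c).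

Definition congruence_modular_variety (sg : signature) (Eqs : term sg -> term sg -> Prop) :=
  forall B : algebra sg, models Eqs B -> con_modular B.

Definition vertex (n : nat) := {ffun 'I_n -> bool}.
Definition cube (n : nat) (A : Type) := vertex n -> A.

(* f with its i-th coordinate set to b: f \cup {(i,b)} for f in 2^(n \ {i}) *)
Definition vupd (n : nat) (f : vertex n) (i : 'I_n) (b : bool) : vertex n :=
  [ffun k => if k == i then b else f k].

Definition vones (n : nat) : vertex n := [ffun _ => true].

Definition refl_cube (n : nat) (A : Type) (i : 'I_n) (j : bool) (g : cube n A) : cube n A :=
  fun v => g (vupd v i j).
Definition sym_cube (n : nat) (A : Type) (i : 'I_n) (g : cube n A) : cube n A :=
  fun v => g (vupd v i (~~ v i)).
Definition cube_k (n : nat) (A : Type) (k : 'I_n) (x y : A) : cube n A :=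
  fun v => if v k then y else x.

Definition is_subuniverse_cube (sg : signature) (B : algebra sg) (n : nat)
    (R : cube n B -> Prop) :=
  forall f (gs : 'I_(arity f) -> cube n B), (forall j, R (gs j)) ->
    R (fun v => op B f (fun j => gs j v)).

Definition is_tolerance_n (sg : signature) (B : algebra sg) (n : nat) (R : cube n B -> Prop) :=
  [/\ is_subuniverse_cube R,
      (forall g i j, R g -> R (refl_cube i j g)) &
      (forall g i, R g -> R (sym_cube i g))].

(* face_i(R) is transitive, written out on cubes *)
Definition faces_transitive (sg : signature) (B : algebra sg) (n : nat) (R : cube n B -> Prop) :=
  forall (i : 'I_n) (g g' : cube n B), R g -> R g' ->
    (forall v, g (vupd v i true) = g' (vupd v i false)) ->
    exists g'', [/\ R g'',
       (forall v, g'' (vupd v i false) = g (vupd v i false)) &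
       (forall v, g'' (vupd v i true) = g' (vupd v i true))].

Definition is_congruence_n (sg : signature) (B : algebra sg) (n : nat) (R : cube n B -> Prop) :=
  is_tolerance_n R /\ faces_transitive R.

Definition Mcubes (sg : signature) (B : algebra sg) (n : nat) (th : 'I_n -> B -> B -> Prop)
    : cube n B -> Prop :=
  fun g => forall R : cube n B -> Prop, is_subuniverse_cube R ->
    (forall k x y, th k x y -> R (cube_k k x y)) -> R g.

Definition Deltacubes (sg : signature) (B : algebra sg) (n : nat) (th : 'I_n -> B -> B -> Prop)
    : cube n B -> Prop :=
  fun g => forall R : cube n B -> Prop, is_congruence_n R ->
    (forall h, Mcubes th h -> R h) -> R g.

Definition central_at (n : nat) (A : Type) (delta : A -> A -> Prop) (i : 'I_n)
    (R : cube n A -> Prop) :=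
  forall g, R g ->
    (forall f : vertex n, (exists k, k != i /\ f k = false) ->
        delta (g (vupd f i false)) (g (vupd f i true))) ->
    delta (g (vupd (vones n) i false)) (g (vupd (vones n) i true)).

Definition central (n : nat) (A : Type) (delta : A -> A -> Prop) (R : cube n A -> Prop) :=
  forall i, central_at delta i R.

Definition least_central_con (sg : signature) (B : algebra sg) (n : nat)
    (R : cube n B -> Prop) : B -> B -> Prop :=
  fun x y => forall delta, is_congruence delta -> central delta R -> delta x y.

Definition TC_comm (sg : signature) (B : algebra sg) (n : nat) (th : 'I_n -> B -> B -> Prop) :=
  least_central_con (Mcubes th).
Definition H_comm (sg : signature) (B : algebra sg) (n : nat) (th : 'I_n -> B -> B -> Prop) :=
  least_central_con (Deltacubes th).

(* Main.v *)
Require Import Defs.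
From mathcomp Require Import all_boot.
From Stdlib Require Import FunctionalExtensionality ProofIrrelevance.

(** Let [d] be a congruence for which [M] is central; since [M] is contained in
    [Delta], the point is that [Delta] is [d]-central too.  [Delta] is exhausted by
    tolerances obtained from [M] by repeatedly replacing [R] with the set [R o_j R]
    of cubes composed of two [R]-cubes along a direction [j], so it suffices that
    this step preserves centrality.

    Modularity enters through Day's criterion: if [b d e] and
    [t(a,b,e,c) d t(a,a,c,c)] for every term [t] with [t(x,y,y,x) = x], then
    [a d c].  Applying such a [t] to the squares of a cube in two directions
    [i], [i'] ("rotating" it) trades [i]-lines for [i']-lines, and all new lines
    over the face [i = 0] are trivial.  For a composite along [j], rotating through
    all the directions successively leaves a pair of [R]-cubes glued along [j]
    whose only nontrivial lines are pivots, to which centrality of [R] applies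
    twice; the criterion then brings the conclusion back to the original cube. *)

Set Implicit Arguments. Unset Strict Implicit. Unset Printing Implicit Defensive.

(** * Day terms *)

(** The last branch covers every index from 3 on, so any term can be read as quaternary. *)
Definition val4 (T : Type) (a b c d : T) (k : nat) : T :=
  match k with 0 => a | 1 => b | 2 => c | _ => d end.

Definition day_term (sg : signature) (A : algebra sg) (t : term sg) :=
  forall a b : A, eval (val4 a b b a) t = a.

Lemma eval_ext (sg : signature) (A : algebra sg) (v w : nat -> A) (t : term sg) :
  v =1 w -> eval v t = eval w t.
Proof. by move=> /functional_extensionality ->. Qed.

Lemma eval_congr (sg : signature) (A : algebra sg) (d : A -> A -> Prop)
  (v w : nat -> A) (t : term sg) :
  is_congruence d -> (forall k, d (v k) (w k)) -> d (eval v t) (eval w t).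
Proof. by move=> [_ _ _ dop] dvw; elim: t => [k|f ts IH] /=; auto. Qed.

Lemma eval4_congr (sg : signature) (A : algebra sg) (d : A -> A -> Prop)
  (t : term sg) (a b c e a' b' c' e' : A) :
  is_congruence d -> d a a' -> d b b' -> d c c' -> d e e' ->
  d (eval (val4 a b c e) t) (eval (val4 a' b' c' e') t).
Proof. by move=> dC ? ? ? ?; apply: eval_congr => // -[|[|[|k]]]. Qed.

Lemma eq_congruence (sg : signature) (A : algebra sg) : is_congruence (@eq (carrier A)).
Proof.
split=> [//|x y -> //|x y z -> //|f a b ab].
by rewrite (functional_extensionality _ _ ab).
Qed.

(** * The algebra of term functions *)

Definition term_fun (sg : signature) (A : algebra sg) :=
  {p : (nat -> A) -> A | exists t, forall v, p v = eval v t}.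

Lemma term_fun_op_proof (sg : signature) (A : algebra sg) (f : Defs.fsym sg)
  (ps : 'I_(arity f) -> term_fun A) :
  exists t, forall v, op A f (fun j => sval (ps j) v) = eval v t.
Proof.
have [ts Hts] := fin_all_exists (fun j => svalP (ps j)).
exists (tapp ts) => v /=; congr (op A f _).
by apply: functional_extensionality => j; apply: Hts.
Qed.

(** Relatively free algebra on countably many variables: terms with equal values on [A] are
    identified. *)
Definition term_fun_alg (sg : signature) (A : algebra sg) : algebra sg :=
  @Algebra sg (term_fun A) (fun f ps => exist _ _ (term_fun_op_proof ps)).

Lemma term_fun_var_proof (sg : signature) (A : algebra sg) (k : nat) :
  exists t, forall v : nat -> A, v k = eval v t.
Proof. by exists (tvar sg k). Qed.

Definition term_fun_var (sg : signature) (A : algebra sg) (k : nat) : term_fun_alg A :=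
  exist _ _ (term_fun_var_proof A k).

Lemma term_fun_inj (sg : signature) (A : algebra sg) (p q : term_fun_alg A) :
  sval p =1 sval q -> p = q.
Proof.
case: p q => [p Hp] [q Hq] /= /functional_extensionality pq.
by move: Hp Hq; rewrite pq => Hp Hq; rewrite (proof_irrelevance _ Hp Hq).
Qed.

Lemma term_fun_eval (sg : signature) (A : algebra sg) (v : nat -> term_fun_alg A)
  (t : term sg) (w : nat -> A) :
  sval (eval v t) w = eval (fun k => sval (v k) w) t.
Proof.
elim: t => [//|f ts IH] /=; congr (op A f _).
by apply: functional_extensionality => j; apply: IH.
Qed.

Lemma term_fun_models (sg : signature) (Eqs : term sg -> term sg -> Prop)
  (A : algebra sg) : models Eqs A -> models Eqs (term_fun_alg A).
Proof.
move=> mA s t st v; apply: term_fun_inj => w; rewrite !term_fun_eval.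
exact: mA.
Qed.

Definition agree_on (sg : signature) (A : algebra sg) (P : (nat -> A) -> Prop)
  (p q : term_fun_alg A) := forall v, P v -> sval p v = sval q v.

Lemma agree_on_congruence (sg : signature) (A : algebra sg) (P : (nat -> A) -> Prop) :
  is_congruence (agree_on P).
Proof.
split=> [p v //|p q pq v Pv|p q r pq qr v Pv|f a b ab v Pv] /=.
- by rewrite pq.
- by rewrite pq ?qr.
- by congr (op A f _); apply: functional_extensionality => j; apply: ab.
Qed.

Lemma meet_congruence (sg : signature) (A : algebra sg) (a b : A -> A -> Prop) :
  is_congruence a -> is_congruence b -> is_congruence (con_meet a b).
Proof.
move=> [ar asy at_ ao] [br bs bt bo]; split.
- by move=> x; split.
- by move=> x y [? ?]; split; auto.
- by move=> x y z [? ?] [? ?]; split; eauto.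
- by move=> f x y xy; split; [apply: ao|apply: bo] => j; case: (xy j).
Qed.

(** * Joins of congruences as alternating chains *)

Fixpoint alt_chain (T : Type) (a b : T -> T -> Prop) (k : nat) (x y : T) : Prop :=
  if k is k'.+1 then exists r s, [/\ a x r, b r s & alt_chain a b k' s y] else x = y.

Section AltChain.
Context (sg : signature) (A : algebra sg) (a b : A -> A -> Prop).
Context (aC : is_congruence a) (bC : is_congruence b).

Lemma alt_chain_mono (k m : nat) (x y : A) :
  k <= m -> alt_chain a b k x y -> alt_chain a b m x y.
Proof.
case: aC bC => [ar _ _ _] [br _ _ _].
elim: k m x => [|k IH] [|m] x //=.
- move=> _ ->; exists y, y; split=> //.
  by elim: m => //= m IH; exists y, y.
- by move=> km [r [s [xr rs sy]]]; exists r, s; split=> //; apply: IH.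
Qed.

Lemma alt_chain_trans (k m : nat) (x y z : A) :
  alt_chain a b k x y -> alt_chain a b m y z -> alt_chain a b (k + m) x z.
Proof.
elim: k x => [|k IH] x /= => [-> //|[r [s [xr rs sy]]] yz].
by exists r, s; split=> //; apply: IH.
Qed.

Lemma alt_chain_sym (k : nat) (x y : A) :
  alt_chain a b k x y -> exists m, alt_chain a b m y x.
Proof.
case: aC bC => [ar asy _ _] [br bsy _ _].
elim: k x => [|k IH] x /= => [->|[r [s [xr rs /IH[m ys]]]]]; first by exists 0.
(* The reversed link starts with [b], so a trivial [a]-step is put before it and a trivial [b]-step
   after it. *)
exists (m + 2); apply: alt_chain_trans ys _; exists s, r; split; auto.
by exists x, x; split; auto.
Qed.

Lemma alt_chain_op (k : nat) (f : Defs.fsym sg) (x y : 'I_(arity f) -> A) :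
  (forall j, alt_chain a b k (x j) (y j)) -> alt_chain a b k (op A f x) (op A f y).
Proof.
case: aC bC => [_ _ _ ao] [_ _ _ bo].
elim: k x => [|k IH] x /= xy; first by rewrite (functional_extensionality _ _ xy).
have [r Hr] := fin_all_exists xy; have [s Hs] := fin_all_exists Hr.
exists (op A f r), (op A f s); split.
- by apply: ao => j; case: (Hs j).
- by apply: bo => j; case: (Hs j).
- by apply: IH => j; case: (Hs j).
Qed.

(** Chains of all lengths form a congruence; under an operation, the finitely many argument chains
    are padded to a common length. *)
Lemma con_join_alt_chain (x y : A) :
  con_join a b x y -> exists k, alt_chain a b k x y.
Proof.
case: (aC) (bC) => [ar _ _ _] [br _ _ _].
move/(_ (fun x y => exists k, alt_chain a b k x y)); apply.
- split.
  + by move=> z; exists 0.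
  + by move=> z w [k]; apply: alt_chain_sym.
  + by move=> z w t [k zw] [m wt]; exists (k + m); apply: alt_chain_trans zw wt.
  + move=> f z w zw; have [k Hk] := fin_all_exists zw.
    exists (\max_j k j); apply: alt_chain_op => j.
    by apply: alt_chain_mono (Hk j); apply: leq_bigmax.
- by move=> z w zw; exists 1, w, w.
- by move=> z w zw; exists 1, z, w.
Qed.

End AltChain.

(* Day's argument: the term functions along an alternating chain from the first
   to the last variable play the role of the Day terms. *)
Lemma day_criterion (sg : signature) (A : algebra sg) (d : A -> A -> Prop) (a b c e : A) :
  con_modular (term_fun_alg A) -> is_congruence d -> d b e ->
  (forall t, day_term A t -> d (eval (val4 a b e c) t) (eval (val4 a a c c) t)) ->
  d a c.
Proof.
move=> modF dC dbe Hday; case: (dC) => [dr ds dt _].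
(* Agreement after identifying variables: 1=2 for [al]; 0=1 and 2=3 for [be]; 0=3 and 1=2 for
   [ga]. *)
pose al := @agree_on _ A (fun v => exists x y z, v = val4 x y y z).
pose be := @agree_on _ A (fun v => exists x z, v = val4 x x z z).
pose ga := @agree_on _ A (fun v => exists x y, v = val4 x y y x).
have alC : is_congruence al by apply: agree_on_congruence.
have beC : is_congruence be by apply: agree_on_congruence.
have gaC : is_congruence ga by apply: agree_on_congruence.
have alga : rel_sub al ga by move=> p q pq v [x [y ->]]; apply: pq; exists x, y, x.
pose X := term_fun_var A.
have [_ H] := modF al be ga alC beC gaC alga (X 0) (X 3).
have {H}/(con_join_alt_chain alC (meet_congruence beC gaC))[k chain] :
    con_join al (con_meet be ga) (X 0) (X 3).
  apply: H; split; last by move=> v [x [y ->]].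
  move=> th [_ _ tht _] alth beth.
  apply: (tht _ (X 1)); first by apply: beth => v [x [z ->]].
  apply: (tht _ (X 2)); first by apply: alth => v [x [y [z ->]]].
  by apply: beth => v [x [z ->]].
(* Along the chain, each [p] stays a Day term and its value at (a,a,c,c) stays [d]-related to [a];
   the final [X 3] has value [c] there. *)
have main m p : alt_chain al (con_meet be ga) m p (X 3) -> ga p (X 0) ->
    d a (sval p (val4 a a c c)) -> d a c.
  have dga q : ga q (X 0) -> d (sval q (val4 a b e c)) (sval q (val4 a a c c)).
    case: (svalP q) => t qt gaq; rewrite !qt; apply: Hday => x y.
    by rewrite -qt gaq //; exists x, y.
  case: gaC => _ gas gat _.
  elim: m p => [|m IH] p /=; first by move=> -> _.
  move=> [r [s [pr [rs rs'] sX]]] gap dap.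
  have gar : ga r (X 0) by apply: (gat _ p) => //; apply/gas/alga.
  apply: (IH s) => //; first by apply: (gat _ r) => //; apply: gas.
  (* A [be]-link keeps the value at (a,a,c,c). An [al]-link keeps that at (a,b,b,c), which [d b e]
     links to (a,b,e,c) and the Day hypothesis to (a,a,c,c). *)
  rewrite -(rs (val4 a a c c)); last by exists a, c.
  apply: (dt _ _ _ dap); apply: (dt _ (sval p (val4 a b e c))); first exact/ds/dga.
  apply: (dt _ (sval r (val4 a b e c))); last exact: dga.
  have del (q : term_fun_alg A) : d (sval q (val4 a b b c)) (sval q (val4 a b e c)).
    by case: (svalP q) => t qt; rewrite !qt; apply: eval4_congr.
  apply: (dt _ (sval p (val4 a b b c))); first exact: ds.
  by rewrite (pr (val4 a b b c)); [apply: del | exists a, b, c].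
exact: main chain _ _.
Qed.

(** * Rotations *)

Lemma vupd_same (n : nat) (f : vertex n) (i : 'I_n) (b c : bool) :
  vupd (vupd f i b) i c = vupd f i c.
Proof. by apply/ffunP=> k; rewrite !ffunE; case: eqP. Qed.

Lemma vupdC (n : nat) (f : vertex n) (i j : 'I_n) (b c : bool) :
  i != j -> vupd (vupd f i b) j c = vupd (vupd f j c) i b.
Proof.
move=> ij; apply/ffunP=> k; rewrite !ffunE.
by case: (eqVneq k j) => // ->; rewrite eq_sym (negPf ij).
Qed.

Lemma vupd_id (n : nat) (f : vertex n) (i : 'I_n) (b : bool) :
  f i = b -> vupd f i b = f.
Proof. by move=> <-; apply/ffunP=> k; rewrite !ffunE; case: eqP => // ->. Qed.

Lemma vupd_at (n : nat) (f : vertex n) (i : 'I_n) (b : bool) : vupd f i b i = b.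
Proof. by rewrite ffunE eqxx. Qed.

Lemma vupd_neq (n : nat) (f : vertex n) (i k : 'I_n) (b : bool) :
  k != i -> vupd f i b k = f k.
Proof. by rewrite ffunE => /negPf ->. Qed.

Lemma vones_at (n : nat) (k : 'I_n) : vones n k = true.
Proof. by rewrite ffunE. Qed.

(** With separate [h] and [g], the square may span a composite that is not in [R], while the rotated
    cube still lies in [R]. *)
Definition rot (sg : signature) (A : algebra sg) (n : nat) (t : term sg) (i i' : 'I_n)
    (h g : cube n A) : cube n A := fun v =>
  eval (val4 (h (vupd (vupd v i' true) i false)) (h (vupd v i false))
             (g v) (g (vupd v i' true))) t.

Section Rotations.
Context (sg : signature) (A : algebra sg) (n : nat).
Implicit Types (t : term sg) (i j k : 'I_n) (f v : vertex n) (g h : cube n A).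
Implicit Types (R : cube n A -> Prop) (d : A -> A -> Prop).

Lemma subuniverse_eval R t (gs : nat -> cube n A) :
  is_subuniverse_cube R -> (forall x, R (gs x)) -> R (fun v => eval (gs^~ v) t).
Proof. by move=> Rsub Rgs; elim: t => [k|s ts IH] /=; auto. Qed.

Lemma rot_in R t i i' h g : is_tolerance_n R -> R h -> R g -> R (rot t i i' h g).
Proof.
move=> [Rsub Rrefl _] Rh Rg.
pose gs := val4 (refl_cube i' true (refl_cube i false h)) (refl_cube i false h)
  g (refl_cube i' true g).
have -> : rot t i i' h g = fun v => eval (gs^~ v) t.
  by apply: functional_extensionality => v; apply: eval_ext => -[|[|[|k]]].
by apply: subuniverse_eval => // -[|[|[|k]]] /=; auto.
Qed.

Lemma rot_true t i i' h g f :
  rot t i i' h g (vupd f i' true) =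
  let a := h (vupd (vupd f i' true) i false) in
  let c := g (vupd f i' true) in eval (val4 a a c c) t.
Proof. by rewrite /rot vupd_same. Qed.

Lemma rot_false t i i' h g f :
  rot t i i' h g (vupd f i' false) =
  eval (val4 (h (vupd (vupd f i' true) i false)) (h (vupd (vupd f i' false) i false))
             (g (vupd f i' false)) (g (vupd f i' true))) t.
Proof. by rewrite /rot vupd_same. Qed.

(** Replacing e by b and c by a turns the two ends into t(a,b,b,a) and t(a,a,a,a), both equal to a.
    Taking equality for [d] shows that a line is trivial. *)
Lemma rot_line d t i i' h g f : is_congruence d -> day_term A t ->
  (forall b, d (h (vupd (vupd f i' b) i false)) (g (vupd f i' b))) ->
  d (rot t i i' h g (vupd f i' false)) (rot t i i' h g (vupd f i' true)).
Proof.
move=> dC Dt dhg; case: (dC) => [dr ds dt _]; rewrite rot_true rot_false /=.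
set a := h _; set b := h _.
apply: (dt _ a); [apply: ds; rewrite -{1}(Dt a b) | rewrite -{1}(Dt a a)];
  by apply: eval4_congr => //; apply: dhg.
Qed.

(** Day's criterion read on a square: a converse of [rot_line], given one good line at [i' = 0]. *)
Lemma rot_line_inv d i i' h g f : con_modular (term_fun_alg A) -> is_congruence d ->
  d (h (vupd (vupd f i' false) i false)) (g (vupd f i' false)) ->
  (forall t, day_term A t ->
     d (rot t i i' h g (vupd f i' false)) (rot t i i' h g (vupd f i' true))) ->
  d (h (vupd (vupd f i' true) i false)) (g (vupd f i' true)).
Proof.
move=> modF dC dbe Hrot; apply: (day_criterion modF dC dbe) => t /Hrot.
by rewrite rot_true rot_false.
Qed.

Lemma line_to d h i f : is_congruence d ->
  d (h (vupd f i false)) (h (vupd f i true)) -> d (h (vupd f i false)) (h f).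
Proof.
move=> [dr _ _ _]; case fi: (f i); first by rewrite (@vupd_id _ f i true).
by rewrite vupd_id.
Qed.

(** Rotation turns supporting [i]-lines into supporting [j]-lines; centrality along [j] gives the
    rotated pivot, and [rot_line_inv] recovers the [i]-pivot. *)
Lemma central_at_change d R i j : con_modular (term_fun_alg A) -> is_congruence d ->
  is_tolerance_n R -> i != j -> central_at d j R -> central_at d i R.
Proof.
move=> modF dC Rtol ij dj g Rg supp; case: (dC) => dr _ _ _.
have o1 : vones n = vupd (vones n) j true by rewrite vupd_id ?vones_at.
rewrite (@vupd_id _ _ i true) ?vones_at // o1.
apply: (@rot_line_inv d i j g g) => // [|t Dt].
  by apply: (@line_to d g i) => //; apply: supp; exists j; rewrite vupd_at eq_sym.
apply: dj; first exact: rot_in.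
move=> f [k [kj fk]]; apply: rot_line => // b.
have [ki|ki] := eqVneq k i; first by rewrite (@vupd_id _ _ i false) // -ki vupd_neq.
by apply: (@line_to d g i) => //; apply: supp; exists k; rewrite vupd_neq.
Qed.

(* Two [R]-cubes [g], [g'] glued along [j]; rotating makes the lines trivial
   below one more direction, collected in [D], until only the pivots are left and
   centrality of [R] applies to [g] and [g'] separately. *)
Lemma glued_pivot d R j : con_modular (term_fun_alg A) -> is_congruence d ->
  is_tolerance_n R -> central d R ->
  forall (D : {set 'I_n}) i g g', R g -> R g' -> i != j -> i \notin D ->
  (forall v, g (vupd v j true) = g' (vupd v j false)) ->
  (forall f, f j = false -> g (vupd f i false) = g (vupd f i true)) ->
  (forall f k, k \in D -> f k = false ->
     g (vupd f i false) = g (vupd f i true) /\ g' (vupd f i false) = g' (vupd f i true)) ->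
  (forall f, f j = true -> (exists k, k != i /\ f k = false) ->
     d (g' (vupd f i false)) (g' (vupd f i true))) ->
  d (g' (vupd (vones n) i false)) (g' (vupd (vones n) i true)).
Proof.
move=> modF dC Rtol dR D; case: (dC) => dr _ _ _; have eqC := eq_congruence A.
(* Induction on the number of directions outside [D]. *)
elim: {D}_.+1 {-2}D (ltnSn #|~: D|) => // m IH D Dm i g g' Rg Rg' ij iD glue g0 trivD supp.
have [i' /and3P[i'i i'j i'D]|none] := pickP [pred k | [&& k != i, k != j & k \notin D]].
  have ji : j != i by rewrite eq_sym.
  have ji' : j != i' by rewrite eq_sym.
  have kD k : k \in D -> k != i' by move=> kD; apply: contraNneq i'D => <-.
  have o1 : vones n = vupd (vones n) i' true by rewrite vupd_id ?vones_at.
  rewrite [X in d _ (g' X)]vupd_id ?vones_at // o1.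
  apply: (@rot_line_inv d i i' g' g') => // [|t Dt].
    by apply: (@line_to d g' i) => //; apply: supp; rewrite ?vupd_neq ?vones_at //; exists i'; rewrite vupd_at.
  (* The rotated lines run along [i'], and those over the face [i = 0] are trivial, so [i] joins
     [D]. *)
  apply: (IH (i |: D) _ i' (rot t i i' g g)).
  - have -> : ~: (i |: D) = ~: D :\ i by apply/setP => k; rewrite !inE negb_or.
    by move: Dm; rewrite (cardsD1 i (~: D)) inE iD.
  - exact: rot_in.
  - exact: rot_in.
  - by [].
  - by rewrite !inE negb_or i'i.
  - by move=> v; rewrite /rot !(vupdC _ _ _ ji') !(vupdC _ _ _ ji) !glue.
  - move=> f fj; apply: rot_line => // b.
    by apply: (@line_to eq g i) => //; apply: g0; rewrite vupd_neq.
  - move=> f k /setU1P[->|kinD] fk; split; apply: rot_line => // b.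
    + by rewrite (@vupd_id _ _ i false) // vupd_neq // eq_sym.
    + by rewrite (@vupd_id _ _ i false) // vupd_neq // eq_sym.
    + by apply: (@line_to eq g i) => //; case: (trivD (vupd f i' b) k); rewrite ?vupd_neq ?kD.
    + by apply: (@line_to eq g' i) => //; case: (trivD (vupd f i' b) k); rewrite ?vupd_neq ?kD.
  - move=> f fj [k [ki' fk]]; apply: rot_line => // b.
    have [ki|ki] := eqVneq k i; first by rewrite (@vupd_id _ _ i false) // -ki vupd_neq.
    by apply: (@line_to d g' i) => //; apply: supp; [rewrite vupd_neq | exists k; rewrite vupd_neq].
have jD k : k != i -> k \notin D -> k = j.
  by move=> ki kD; apply/eqP; move: (none k); rewrite /= ki kD andbT => /negbFE.
(* All supporting [i]-lines of [g] are trivial: a coordinate in [D] vanishes, or else the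
   [j]-coordinate does. *)
have piv : d (g (vupd (vones n) i false)) (g (vupd (vones n) i true)).
  apply: dR => // f [k [ki fk]].
  have [kD|kD] := boolP (k \in D); first by case: (trivD f k) => // ->.
  by rewrite g0 // -(jD k).
apply: dR => // f [k [ki fk]].
have [l /andP[lD /negbTE fl]|fD] := pickP [pred l | (l \in D) && ~~ f l].
  by case: (trivD f l) => // _ ->.
have kj : k = j by apply: jD => //; apply/negP => kD; have := fD k; rewrite /= kD fk.
(* The one remaining supporting line of [g'] has [j = 0] and its other coordinates 1; by the gluing
   it is the pivot line of [g]. *)
have E b : g' (vupd f i b) = g (vupd (vones n) i b).
  rewrite -(@vupd_id _ (vupd f i b) j false) ?vupd_neq -?kj // kj -glue.
  congr (g _); apply/ffunP => l; rewrite !ffunE.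
  case: (eqVneq l j) => [->|lj]; first by rewrite eq_sym (negPf ij).
  case: (eqVneq l i) => // li; have := fD l; rewrite /=.
  by have [_ /negbFE|/(jD _ li)/eqP] := boolP (l \in D); rewrite ?(negPf lj).
by rewrite !E.
Qed.

End Rotations.

(** * Composition along a direction *)

Definition comp_cube (n : nat) (T : Type) (j : 'I_n) (R : cube n T -> Prop)
    (x : cube n T) : Prop :=
  exists g g', [/\ R g, R g', forall v, g (vupd v j true) = g' (vupd v j false),
    forall v, x (vupd v j false) = g (vupd v j false) &
    forall v, x (vupd v j true) = g' (vupd v j true)].

Section Composition.
Context (sg : signature) (A : algebra sg) (n : nat).
Implicit Types (i j : 'I_n) (R : cube n A -> Prop) (d : A -> A -> Prop).

Lemma comp_cube_sub R j x : is_tolerance_n R -> R x -> comp_cube j R x.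
Proof.
move=> [_ Rrefl _] Rx; exists x, (refl_cube j true x).
by split=> //; auto; move=> v; rewrite /refl_cube vupd_same.
Qed.

Lemma comp_cube_tolerance R j : is_tolerance_n R -> is_tolerance_n (comp_cube j R).
Proof.
move=> Rtol; case: (Rtol) => Rsub Rrefl Rsym; split.
- move=> f xs Rxs; have [gs Hgs] := fin_all_exists Rxs.
  have [gs' H] := fin_all_exists Hgs.
  exists (fun v => op A f (gs^~ v)), (fun v => op A f (gs'^~ v)).
  split; try (by apply: Rsub => k; case: (H k));
    move=> v; congr (op A f _); apply: functional_extensionality => k; by case: (H k).
- move=> x i b [g [g' [Rg Rg' gl xg xg']]].
  have [->|ij] := eqVneq i j.
    have Rx : comp_cube j R (refl_cube j false g) by apply: comp_cube_sub; auto.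
    have Rx' : comp_cube j R (refl_cube j true g') by apply: comp_cube_sub; auto.
    have -> : refl_cube j b x = if b then refl_cube j true g' else refl_cube j false g.
      by apply: functional_extensionality => v; rewrite /refl_cube; case: b.
    by case: b.
  exists (refl_cube i b g), (refl_cube i b g').
  have ji : j != i by rewrite eq_sym.
  by split; auto; move=> v; rewrite /refl_cube !(vupdC _ _ _ ji).
- move=> x i [g [g' [Rg Rg' gl xg xg']]].
  have [->|ij] := eqVneq i j.
    (* Reversal along [j] also swaps the two factors. *)
    exists (sym_cube j g'), (sym_cube j g).
    by split; auto; move=> v; rewrite /sym_cube !vupd_at !vupd_same.
  exists (sym_cube i g), (sym_cube i g').
  have ji : j != i by rewrite eq_sym.
  by split; auto; move=> v; rewrite /sym_cube !(vupd_neq _ _ ij) !(vupdC _ _ _ ji).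
Qed.

Lemma comp_cube_central d R j : con_modular (term_fun_alg A) -> is_congruence d ->
  is_tolerance_n R -> 1 < n -> central d R -> central d (comp_cube j R).
Proof.
move=> modF dC Rtol n1 dR.
(* The composite is again a tolerance, so centrality along [j] carries over to the other
   directions. *)
suff dj : central_at d j (comp_cube j R).
  move=> i; have [->//|ij] := eqVneq i j.
  exact: central_at_change modF dC (comp_cube_tolerance j Rtol) ij dj.
have [i ij] : exists i, i != j.
  apply/existsP; rewrite -negb_forall; apply/negP => /forallP all_j.
  have : #|'I_n| <= 1 by apply/fintype_le1P => x y; rewrite (eqP (all_j x)) (eqP (all_j y)).
  by rewrite card_ord leqNgt n1.
have ji : j != i by rewrite eq_sym.
move=> x [g [g' [Rg Rg' gl xg xg']]] supp; rewrite xg xg'.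
have o1 : vones n = vupd (vones n) i true by rewrite vupd_id ?vones_at.
rewrite [X in d _ (g' X)]vupd_id ?vones_at // o1.
have lt (f : vertex n) : f j = true -> (exists k, k != j /\ f k = false) ->
    d (g (vupd f j false)) (g' f).
  by move=> fj /supp; rewrite xg xg' (@vupd_id _ f j true).
apply: (@rot_line_inv _ _ _ d j i g g') => // [|t Dt].
  by apply: lt; [rewrite vupd_neq ?vones_at | exists i; rewrite vupd_at].
(* The rotated pair is again glued along [j]; in its first cube the [i]-lines over [j = 0] are
   trivial, so the argument can start with [D] empty. *)
apply: (@glued_pivot _ _ _ d R j modF dC Rtol dR set0 i (rot t j i g g)) => //.
- exact: rot_in.
- exact: rot_in.
- by rewrite inE.
- move=> v; rewrite /rot !(vupdC _ _ _ ji) !vupd_same gl.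
  by congr (eval (val4 _ _ _ _) _); rewrite gl.
- move=> f fj; apply: rot_line => //; first exact: eq_congruence.
  by move=> b; rewrite (@vupd_id _ _ j false) // vupd_neq.
- by move=> f k; rewrite inE.
- move=> f fj [k [ki fk]]; apply: rot_line => // b.
  have kj : k != j by apply: contraFneq fk => ->.
  by apply: lt; [rewrite vupd_neq | exists k; rewrite vupd_neq].
Qed.

End Composition.

(** * Iterated composition *)

Fixpoint comp_iter (n : nat) (T : Type) (dir : nat -> 'I_n) (R : cube n T -> Prop)
    (k : nat) : cube n T -> Prop :=
  if k is k'.+1 then comp_cube (dir k') (comp_iter dir R k') else R.

Section Iteration.
Context (sg : signature) (A : algebra sg) (n : nat) (dir : nat -> 'I_n).
Implicit Type R : cube n A -> Prop.

Lemma comp_iter_tolerance R k : is_tolerance_n R -> is_tolerance_n (comp_iter dir R k).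
Proof. by move=> Rtol; elim: k => //= k; apply: comp_cube_tolerance. Qed.

Lemma comp_iter_mono R k m x : is_tolerance_n R -> k <= m ->
  comp_iter dir R k x -> comp_iter dir R m x.
Proof.
move=> Rtol /subnKC <-; elim: (m - k) => [|l IH] Rx; first by rewrite addn0.
by rewrite addnS /=; apply: comp_cube_sub; [apply: comp_iter_tolerance | apply: IH].
Qed.

Lemma comp_iter_central d R k : con_modular (term_fun_alg A) -> is_congruence d ->
  is_tolerance_n R -> 1 < n -> central d R -> central d (comp_iter dir R k).
Proof.
move=> modF dC Rtol n1 dR; elim: k => //= k IH.
by apply: comp_cube_central => //; apply: comp_iter_tolerance.
Qed.

Lemma comp_iter_congruence R : is_tolerance_n R ->
  (forall i k, exists2 m, k <= m & dir m = i) ->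
  is_congruence_n (fun x => exists k, comp_iter dir R k x).
Proof.
move=> Rtol dirP; have tol k := comp_iter_tolerance k Rtol; split; first split.
- move=> f gs Rgs; have [k Hk] := fin_all_exists Rgs; exists (\max_j k j).
  have [Rsub _ _] := tol (\max_j k j); apply: Rsub => j.
  by apply: comp_iter_mono (Hk j) => //; apply: leq_bigmax.
- by move=> g i b [k Rg]; exists k; case: (tol k) => _ + _; apply.
- by move=> g i [k Rg]; exists k; case: (tol k) => _ _; apply.
- move=> i g g' [k Rg] [k' Rg'] gl.
  (* At a stage [m] containing both cubes and with [dir m = i], their composite enters at stage
     [m.+1]. *)
  have [m km dm] := dirP i (maxn k k'); move: km; rewrite geq_max => /andP[km k'm].
  exists (fun v : vertex n => if v i then g' v else g v); split.
  + exists m.+1; rewrite /= dm; exists g, g'.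
    split=> //; [exact: comp_iter_mono km Rg | exact: comp_iter_mono k'm Rg' | |];
      by move=> v; rewrite vupd_at.
  + by move=> v; rewrite vupd_at.
  + by move=> v; rewrite vupd_at.
Qed.

End Iteration.

(** * The generating tolerance and the equality of the commutators *)

Lemma Mcubes_tolerance (sg : signature) (A : algebra sg) (n : nat)
  (th : 'I_n -> A -> A -> Prop) :
  (forall k, is_congruence (th k)) -> is_tolerance_n (Mcubes th).
Proof.
move=> thC.
have Msub : is_subuniverse_cube (Mcubes th).
  move=> f gs Mgs R Rsub Rgen; apply: (Rsub f gs) => j; exact: (Mgs j R Rsub Rgen).
have Mgen k x y : th k x y -> Mcubes th (cube_k k x y) by move=> xy R _; apply.
split=> // g i => [b|] Mg.
(* The cubes whose reflection lies in [Mcubes th] form a subuniverse, so generators suffice. *)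
- apply: (Mg (fun g => Mcubes th (refl_cube i b g))) => [f gs Mgs|k x y xy].
    exact: (Msub f (fun j => refl_cube i b (gs j))).
  have [ki|ki] := eqVneq k i.
    have -> : refl_cube i b (cube_k k x y) = cube_k k (if b then y else x) (if b then y else x).
      by apply: functional_extensionality => v; rewrite /refl_cube /cube_k ki vupd_at if_same.
    by apply: Mgen; case: (thC k).
  have -> : refl_cube i b (cube_k k x y) = cube_k k x y.
    by apply: functional_extensionality => v; rewrite /refl_cube /cube_k vupd_neq.
  exact: Mgen.
- apply: (Mg (fun g => Mcubes th (sym_cube i g))) => [f gs Mgs|k x y xy].
    exact: (Msub f (fun j => sym_cube i (gs j))).
  have [ki|ki] := eqVneq k i.
    have -> : sym_cube i (cube_k k x y) = cube_k k y x.
      apply: functional_extensionality => v; rewrite /sym_cube /cube_k ki vupd_at.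
      by case: (v i).
    by apply: Mgen; case: (thC k) => _ ths _ _; apply: ths.
  have -> : sym_cube i (cube_k k x y) = cube_k k x y.
    by apply: functional_extensionality => v; rewrite /sym_cube /cube_k vupd_neq.
  exact: Mgen.
Qed.

Theorem theorem2p6 (sg : signature) (Eqs : term sg -> term sg -> Prop)
  (A : algebra sg) (n : nat) (th : 'I_n -> A -> A -> Prop) :
  congruence_modular_variety Eqs -> models Eqs A -> 2 <= n ->
  (forall k, is_congruence (th k)) ->
  rel_eq (TC_comm th) (H_comm th).
Proof.
move=> modV mA n1 thC x y; split=> xy d dC dR; apply: xy => // i g.
  by move=> Mg; apply: dR => R _; apply.
have modF := modV _ (term_fun_models mA).
have Mtol := Mcubes_tolerance thC.
have n0 : 0 < n by apply: ltnW.
(* Cycling modulo [n] makes each direction recur arbitrarily late. *)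
pose dir k := Ordinal (ltn_pmod k n0).
have dirP j k : exists2 m, k <= m & dir m = j.
  exists (k * n + j); first by rewrite (leq_trans (leq_pmulr k n0)) ?leq_addr.
  by apply: val_inj; rewrite /= modnMDl modn_small.
(* The union of the stages is an [n]-dimensional congruence containing [Mcubes th], so each cube of
   [Deltacubes th] lies in some stage. *)
move=> /(_ _ (comp_iter_congruence Mtol dirP))[|k Rg]; first by move=> h Mh; exists 0.
exact: comp_iter_central modF dC Mtol n1 dR i g Rg.
Qed.
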